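(* Let $G=(V,E)$ be an undirected graph on $n$ vertices with positive edge weights $w:E\to\mathbb{R}_{+}$, and let $k$ be an integer with $1\le k\le n$. Then the algorithm $ChALK(G,k)$ returns an induced subgraph $H$ of $G$ with at least $k$ vertices and density $d(H)\ge \mathrm{dal}(G,k)/3$. That is, $ChALK$ is a $3$-approximation algorithm for the densest at-least-$k$-subgraph problem.
   Context: For an induced subgraph $H$ of $G$: the weighted degree $w(v,H)$ of a vertex $v$ in $H$ is the sum of the weights of the edges of $H$ incident with $v$; $W(H)$ is the sum of the weights of the edges of $H$; $|H|$ is the number of vertices of $H$; and the density of $H$ is $d(H)=W(H)/|H|$. $\mathrm{dal}(G,k)$ denotes the maximum density of an induced subgraph of $G$ with at least $k$ vertices. The algorithm $ChALK(G,k)$ is: set $H_n=G$; for $i=n,n-1,\dots,1$, let $r_i$ be the minimum weighted degree of a vertex in $H_i$, let $v_i$ be a vertex (chosen arbitrarily among ties) with $w(v_i,H_i)=r_i$, and let $H_{i-1}$ be the induced subgraph obtained by removing $v_i$ from $H_i$ (so $H_i$ has exactly $i$ vertices). Then compute $d(H_i)$ for every $i\in[1,n]$ and output the $H_i$ with $i\ge k$ maximizing $d(H_i)$. *)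

(* Defs.v *)
From mathcomp Require Import all_boot all_order all_algebra.
From mathcomp Require Import reals.

Set Implicit Arguments.
Unset Strict Implicit.
Unset Printing Implicit Defensive.

Import Order.TTheory GRing.Theory Num.Theory.
Local Open Scope ring_scope.

(* Edges are 2-element vertex sets. Values of [weight] outside [edges] are
   irrelevant: every sum below ranges over edges only. *)
Record wgraph (R : realType) (V : finType) := WGraph {
  edges : {set {set V}};
  weight : {set V} -> R;
  edges_card2 : forall e : {set V}, e \in edges -> #|e| = 2;
  weight_gt0 : forall e : {set V}, e \in edges -> 0 < weight e
}.

Section Density.

Variables (R : realType) (V : finType) (G : wgraph R V).

(* An induced subgraph of G is represented by its vertex set H. *)
Definition induced_edges (H : {set V}) : {set {set V}} :=
  [set e in edges G | e \subset H].

Definition wdegree (v : V) (H : {set V}) : R :=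
  \sum_(e in induced_edges H | v \in e) weight G e.

Definition total_weight (H : {set V}) : R :=
  \sum_(e in induced_edges H) weight G e.

Definition density (H : {set V}) : R := total_weight H / #|H|%:R.

(* A genuine maximum whenever k <= #|V|, since [set: V] is then admissible. *)
Definition dal (k : nat) : R :=
  density [arg max_(H > [set: V] | (k <= #|H|)%N) density H]%O.

(* H and v list the H_i and v_i of one execution, for one resolution of the
   ties; only the H_i with i <= #|V| and the v_i with 0 < i <= #|V| matter. *)
Definition peeling (H : nat -> {set V}) (v : nat -> V) : Prop :=
  H #|V| = [set: V] /\
  forall i : nat, (0 < i <= #|V|)%N ->
    [/\ v i \in H i,
        forall u : V, u \in H i -> wdegree (v i) (H i) <= wdegree u (H i)
      & H i.-1 = H i :\ v i].

(* S is a possible output of ChALK(G, k). *)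
Definition ChALK_returns (k : nat) (S : {set V}) : Prop :=
  exists (H : nat -> {set V}) (v : nat -> V),
    peeling H v /\
    exists i : nat,
      [/\ (k <= i <= #|V|)%N, S = H i
        & forall j : nat, (k <= j <= #|V|)%N -> density (H j) <= density (H i)].

End Density.

(* Main.v *)
(** Let [S] be an optimal set of density [d].  If some [H_i] with [k <= i] has
    minimum weighted degree at least [2d/3], then its density is at least [d/3],
    since the degrees sum to twice the total weight.  Otherwise every vertex
    deleted on the way down to [H_k] costs [S] less than [2d/3], so [S], whose
    total weight is [d |S|], keeps at least [d |S| / 3 >= d k / 3] inside
    [H_k]. *)

Require Import Defs.
From mathcomp Require Import all_boot all_order all_algebra.
From mathcomp Require Import reals.
From mathcomp Require Import lra.

Import Order.TTheory GRing.Theory Num.Theory.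
Local Open Scope ring_scope.

Section WeightedGraph.

Variables (R : realType) (V : finType) (G : wgraph R V).
Implicit Types (A B : {set V}) (u v : V).

Lemma mem_induced_edges A (e : {set V}) :
  (e \in induced_edges G A) = (e \in edges G) && (e \subset A).
Proof. by rewrite inE. Qed.

Lemma total_weight_ge0 A : 0 <= total_weight G A.
Proof.
apply: sumr_ge0 => e; rewrite mem_induced_edges => /andP[eG _].
exact: ltW (weight_gt0 eG).
Qed.

Lemma density_ge0 A : 0 <= density G A.
Proof. by rewrite divr_ge0 ?total_weight_ge0 ?ler0n. Qed.

(** Edges inside [B] but not inside [A] contribute positive weights. The filter [P] lets one
    argument cover both weighted degrees and total weight. *)
Lemma sum_weight_le (P : pred {set V}) A B :
  A \subset B ->
  \sum_(e in induced_edges G A | P e) weight G e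
    <= \sum_(e in induced_edges G B | P e) weight G e.
Proof.
move=> sAB; rewrite [leRHS](bigID (fun e : {set V} => e \subset A)) /=.
rewrite (eq_bigl (fun e => (e \in induced_edges G B) && P e
                           && (e \subset A))); last first.
  move=> e; rewrite !mem_induced_edges -!andbA; case: (e \in edges G) => //=.
  by case sA: (e \subset A); rewrite ?(subset_trans sA sAB) ?andbF ?andbT.
rewrite lerDl; apply: sumr_ge0 => e.
rewrite mem_induced_edges => /andP[/andP[/andP[eG _] _] _].
exact: ltW (weight_gt0 eG).
Qed.

Lemma wdegree_le u A B : A \subset B -> wdegree G u A <= wdegree G u B.
Proof. exact: sum_weight_le. Qed.

Lemma total_weight_le A B :
  A \subset B -> total_weight G A <= total_weight G B.
Proof.
move=> sAB; rewrite /total_weight; under eq_bigl do rewrite -[_ \in _]andbT.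
under [leRHS]eq_bigl do rewrite -[_ \in _]andbT.
exact: (sum_weight_le predT).
Qed.

Lemma total_weight_D1 v A :
  total_weight G A = wdegree G v A + total_weight G (A :\ v).
Proof.
rewrite /total_weight (bigID (fun e : {set V} => v \in e)) /=; congr (_ + _).
by apply: eq_bigl => e; rewrite !mem_induced_edges subsetD1 andbA.
Qed.

Lemma wdegree_notin v A : v \notin A -> wdegree G v A = 0.
Proof.
move=> vA; apply: big_pred0 => e; rewrite mem_induced_edges.
apply/negP => /andP[/andP[_ /subsetP sA] ve].
by rewrite sA in vA.
Qed.

(** Handshake identity: after exchanging the two sums, each edge is counted once at each of its two
    endpoints. *)
Lemma sum_wdegree A :
  \sum_(u in A) wdegree G u A = 2%:R * total_weight G A.
Proof.
rewrite /wdegree /total_weight big_distrr /=.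
under eq_bigr => u _ do rewrite big_mkcondr /=.
rewrite exchange_big /=; apply: eq_bigr => e.
rewrite mem_induced_edges => /andP[eG sA].
rewrite -big_mkcondr /= (eq_bigl (mem e)); last first.
  by move=> u /=; case ue: (u \in e); rewrite ?andbF ?(subsetP sA _ ue).
by rewrite sumr_const (edges_card2 eG) mulr_natl.
Qed.

Lemma le_density_min_wdegree (t : R) A :
  (0 < #|A|)%N -> (forall u, u \in A -> t <= wdegree G u A) ->
  t / 2%:R <= density G A.
Proof.
move=> A_gt0 tle; rewrite /density ler_pdivlMr ?ltr0n //.
have : \sum_(u in A) t <= \sum_(u in A) wdegree G u A by exact: ler_sum.
rewrite sumr_const sum_wdegree -mulr_natr; lra.
Qed.

(** Deleting [v] from [A] costs at most [t] in weight and gives back [t] through the smaller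
    cardinal; if [v] lies outside [A], nothing changes. So weight minus [t] times size acts as a
    potential that cheap deletions never lower. *)
Lemma excess_D1 (t : R) v A :
  wdegree G v A <= t ->
  total_weight G A - t * #|A|%:R
    <= total_weight G (A :\ v) - t * #|A :\ v|%:R.
Proof.
move=> le_t; rewrite (total_weight_D1 v A) (cardsD1 v A).
case: (boolP (v \in A)) => [vA|/wdegree_notin ->]; last by rewrite add0n add0r.
rewrite natrD /= mulrDr mulr1; lra.
Qed.

Section Peeling.

Variables (H : nat -> {set V}) (v : nat -> V).
Hypothesis peelH : peeling G H v.

Lemma peeling_card i : (i <= #|V|)%N -> #|H i| = i.
Proof.
(* Writing [i] as [#|V| - m] turns the downward run into an induction on the number [m] of
   deletions. *)
case: peelH => HV step /subKn <-.
elim: (#|V| - i)%N (leq_subr i #|V|) => [_|m IHm lt_mn].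
  by rewrite subn0 HV cardsT.
have i_gt0 : (0 < #|V| - m)%N by rewrite subn_gt0.
rewrite subnS; have [|vH _ ->] := step (#|V| - m)%N.
  by rewrite i_gt0 leq_subr.
have := cardsD1 (v (#|V| - m)%N) (H (#|V| - m)%N).
by rewrite vH (IHm (ltnW lt_mn)) add1n => /(congr1 predn) ->.
Qed.

(** The trace of [A] on the current set follows the run: each deletion removes [v j] from
    [A :&: H j], where its degree is at most its degree in [H j], so [excess_D1] telescopes. *)
Lemma peeling_excess (t : R) A i :
  (i <= #|V|)%N ->
  (forall j, (i < j <= #|V|)%N -> wdegree G (v j) (H j) <= t) ->
  total_weight G A - t * #|A|%:R
    <= total_weight G (A :&: H i) - t * #|A :&: H i|%:R.
Proof.
case: peelH => HV step /subKn <-.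
elim: (#|V| - i)%N (leq_subr i #|V|) => [_|m IHm lt_mn] le_t.
  by rewrite subn0 HV setIT.
have i_gt0 : (0 < #|V| - m)%N by rewrite subn_gt0.
have lt_i : (#|V| - m.+1 < #|V| - m)%N by rewrite subnS prednK.
apply: le_trans (IHm (ltnW lt_mn) _) _ => [j /andP[lt_j le_j]|].
  by apply: le_t; rewrite le_j (ltn_trans lt_i lt_j).
rewrite subnS; have [|_ _ ->] := step (#|V| - m)%N.
  by rewrite i_gt0 leq_subr.
rewrite setIDA; apply: excess_D1.
apply: le_trans (wdegree_le _ _ _ (subsetIr _ _)) _.
by apply: le_t; rewrite lt_i leq_subr.
Qed.

Lemma peeling_third A k :
  (0 < k <= #|V|)%N -> (k <= #|A|)%N ->
  exists2 i, (k <= i <= #|V|)%N & density G A / 3%:R <= density G (H i).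
Proof.
move=> /andP[k_gt0 le_kV] le_kA; set d := density G A.
have d_ge0 : 0 <= d := density_ge0 A.
(* This threshold balances the two cases: [t / 2] and [d - t] both equal [d / 3]. *)
pose t := 2%:R * d / 3%:R.
have [/existsP[/= i /andP[le_ki t_le]]|/existsPn small] :=
  boolP [exists i : 'I_#|V|.+1, (k <= i)%N && (t <= wdegree G (v i) (H i))].
  have le_iV : (i <= #|V|)%N by rewrite -ltnS.
  exists (nat_of_ord i); first by rewrite le_ki.
  have i_gt0 : (0 < i)%N := leq_trans k_gt0 le_ki.
  have -> : d / 3%:R = t / 2%:R by rewrite /t; lra.
  apply: le_density_min_wdegree => [|u uH]; first by rewrite peeling_card.
  (* As [v i] has minimum degree in [H i], its bound passes to every vertex there. *)
  apply: le_trans t_le _; case: peelH => _ /(_ i).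
  by rewrite i_gt0 le_iV => /(_ isT)[_ + _]; apply.
exists k; first by rewrite leqnn.
have A_gt0 : (0 < #|A|)%N := leq_trans k_gt0 le_kA.
have WA : total_weight G A = d * #|A|%:R.
  by rewrite /d /density divfK // pnatr_eq0 -lt0n.
have : total_weight G A - t * #|A|%:R
         <= total_weight G (A :&: H k) - t * #|A :&: H k|%:R.
  apply: peeling_excess => // j /andP[lt_kj le_jV].
  rewrite -ltnS in le_jV.
  by have := small (Ordinal le_jV); rewrite /= (ltnW lt_kj) /= -ltNge => /ltW.
have t_ge0 : 0 <= t * #|A :&: H k|%:R.
  by rewrite mulr_ge0 ?ler0n // /t; lra.
have leW : total_weight G (A :&: H k) <= total_weight G (H k).
  exact: total_weight_le (subsetIr _ _).
have dk : d * k%:R <= d * #|A|%:R by rewrite ler_wpM2l // ler_nat.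
rewrite /(density G (H k)) peeling_card // ler_pdivlMr ?ltr0n //.
rewrite WA /t; rewrite /t in t_ge0; lra.
Qed.

End Peeling.

(** Since [peeling] is a relation, a run has to be exhibited: a minimum-degree vertex is deleted
    repeatedly, starting from [[set: V]]. *)
Lemma peeling_exists : (0 < #|V|)%N -> exists H (v : nat -> V), peeling G H v.
Proof.
move=> /card_gt0P[v0 _].
(* The arg min needs a seed in [A]; [[pick u in A]] gives one when [A] is nonempty, and [v0] only
   fills the empty case. *)
pose next A := [arg min_(u < odflt v0 [pick u in A] in A) wdegree G u A]%O.
pose H i := iter (#|V| - i) (fun A => A :\ next A) [set: V].
have nextP A : (0 < #|A|)%N ->
    next A \in A /\ forall u, u \in A -> wdegree G (next A) A <= wdegree G u A.
  move=> /card_gt0P[x xA]; rewrite /next; case: arg_minP => //.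
  by case: pickP => [//|/(_ x)]; rewrite xA.
have stepH i : (0 < i <= #|V|)%N -> H i.-1 = H i :\ next (H i).
  move=> /andP[i_gt0 le_iV]; rewrite /H.
  by case: i i_gt0 le_iV => // i _ lt_iV /=; rewrite -[in LHS](subnSK lt_iV).
(* A lower bound is enough to keep [H i] nonempty for positive [i]; it holds because a deletion
   removes at most one vertex. *)
have leH i : (i <= #|V|)%N -> (i <= #|H i|)%N.
  move=> /subKn <-; elim: (#|V| - i)%N (leq_subr i #|V|) => [_|m IHm lt_mn].
    by rewrite /H subn0 subnn cardsT.
  have i_gt0 : (0 < #|V| - m)%N by rewrite subn_gt0.
  rewrite subnS stepH ?i_gt0 ?leq_subr //.
  rewrite -subn1 leq_subLR (leq_trans (IHm (ltnW lt_mn))) //.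
  by rewrite (cardsD1 (next (H (#|V| - m)%N))) leq_add2r leq_b1.
exists H, (next \o H); split=> [|i /andP[i_gt0 le_iV]].
  by rewrite /H subnn.
have [vH vmin] := nextP _ (leq_trans i_gt0 (leH _ le_iV)).
by split=> //; rewrite stepH ?i_gt0.
Qed.

Lemma ChALK_returns_exists k :
  (1 <= k <= #|V|)%N -> exists S : {set V}, ChALK_returns G k S.
Proof.
move=> /andP[k_gt0 le_kV].
have [H [v peelH]] := peeling_exists (leq_trans k_gt0 le_kV).
(* Indices range up to [#|V|] inclusive; the seed [ord_max] is [#|V|] itself, admissible by
   [le_kV]. *)
have [i le_ki maxi] := @arg_maxP _ _ 'I_#|V|.+1 ord_max
  (fun i => (k <= i)%N) (fun i => density G (H i)) le_kV.
exists (H i), H, v; split=> //; exists (nat_of_ord i); split=> //.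
  by apply/andP; split; [exact: le_ki | rewrite -ltnS].
move=> j /andP[le_kj]; rewrite -ltnS => le_jV.
exact: maxi (Ordinal le_jV) le_kj.
Qed.

Lemma dal_witness k :
  (k <= #|V|)%N -> exists2 A : {set V}, (k <= #|A|)%N & dal G k = density G A.
Proof.
move=> le_kV; rewrite /dal; case: arg_maxP => [|A le_kA _]; last by exists A.
by rewrite cardsT.
Qed.

End WeightedGraph.

Theorem theorem1 (R : realType) (V : finType) (G : wgraph R V) (k : nat)
    (hk : (1 <= k <= #|V|)%N) :
  (exists S : {set V}, ChALK_returns G k S) /\
  (forall S : {set V}, ChALK_returns G k S ->
     (k <= #|S|)%N /\ dal G k / 3%:R <= density G S).
Proof.
split=> [|S [H [v [peelH [i [/andP[le_ki le_iV] -> maxi]]]]]].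
  exact: ChALK_returns_exists hk.
split; first by rewrite (peeling_card _ _ _ _ _ peelH).
have [_ le_kV] := andP hk.
have [A le_kA ->] := dal_witness _ _ G _ le_kV.
have [j j_range le_j] := peeling_third _ _ _ _ _ peelH _ _ hk le_kA.
(* The returned set is at least as dense as the good [H j], whose index is an admissible
   competitor. *)
exact: le_trans le_j (maxi j j_range).
Qed.
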